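(* If $\alpha<1/3$, then $$M^-_{\alpha,n}\ \ge\ \sqrt{(6\alpha-9\alpha^2)^{-2/n}-1},\qquad\text{where}\qquad M^-_{\alpha,n}=\inf_{L\in\mathcal L_{\alpha,n}}\ \sup_{P\in\mathcal N}\ \sigma^{-1}(P)\cdot W_{2\alpha}(L,P).$$
   Context: $\mathcal N=\{N(\mu,\sigma^2):\mu\in\mathbb R,\sigma>0\}$ is the class of all nondegenerate normal distributions on $\mathbb R$; for $P=N(\mu,\sigma^2)\in\mathcal N$ write $\mu(P)=\mu$ and $\sigma(P)=\sigma$. $\alpha$ is the error level and $n$ is the fixed sample size; $X_1,\dots,X_n$ are i.i.d. from $P$, and $P(\cdot)$ denotes probability under this sampling. $\mathcal L_{\alpha,n}$ is the set of all lower $(1-\alpha)$-confidence bounds for the mean $\mu$ over $\mathcal N$ with fixed sample size $n$, i.e. functions $L:\mathbb R^n\to\mathbb R$ such that $P(\mu(P)\ge L(X_1,\dots,X_n))\ge 1-\alpha$ for all $P\in\mathcal N$. For $\varepsilon>0$, $P\in\mathcal N$ and $L\in\mathcal L_{\alpha,n}$, $W_\varepsilon(L,P)$ denotes the $\varepsilon$-upper quantile of the random variable $\mu(P)-L(X_1,\dots,X_n)$ under $P$, i.e. $P(\mu(P)-L(X_1,\dots,X_n)\ge W_\varepsilon(L,P))=\varepsilon$. *)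

(* Defs.v *)
From HB Require Import structures.
From mathcomp Require Import all_boot all_order all_algebra.
From mathcomp Require Import all_classical all_reals all_analysis.

Set Implicit Arguments.
Unset Strict Implicit.
Unset Printing Implicit Defensive.
Import Order.TTheory GRing.Theory Num.Theory.
Import numFieldNormedType.Exports.

Local Open Scope classical_set_scope.
Local Open Scope ring_scope.

Section iid.
Context {d : measure_display} {T : measurableType d} {R : realType}.

Definition cons_pair n (x : T * n.-tuple T) : n.+1.-tuple T :=
  [tuple of x.1 :: x.2].

Lemma measurable_cons_pair n :
  measurable_fun [set: T * n.-tuple T] (@cons_pair n).
Proof. exact: measurable_cons. Qed.

HB.instance Definition _ n :=
  isMeasurableFun.Build _ _ _ _ (@cons_pair n) (@measurable_cons_pair n).

(* The law of (X_1, ..., X_n) with X_1, ..., X_n i.i.d. from P, i.e. the n-fold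
   product P \x ... \x P on n.-tuple T; see iid_box. *)
Fixpoint iid (P : probability T R) (n : nat) : probability (n.-tuple T) R :=
  match n with
  | 0 => \d_[tuple]
  | m.+1 => distribution (P \x iid P m)%E (@cons_pair m)
  end.

Lemma iid_box (P : probability T R) (n : nat) (A : 'I_n -> set T) :
  (forall i, measurable (A i)) ->
  iid P n [set x | forall i, A i (tnth x i)] = (\prod_(i < n) P (A i))%E.
Proof.
elim: n A => [|n IHn] A mA.
  rewrite big_ord0 /= /dirac indicE mem_set//=.
  by case.
rewrite big_ord_recl -IHn//.
have mB : measurable [set x : n.-tuple T | forall i, A (lift ord0 i) (tnth x i)].
  rewrite (_ : [set _ | _] =
      \big[setI/setT]_(i < n) ((@tnth n T)^~ i @^-1` A (lift ord0 i))).
    apply: bigsetI_measurable => i _; rewrite -[X in measurable X]setTI.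
    exact: measurable_tnth.
  apply/seteqP; split=> x /=; rewrite -bigcap_seq/=.
    by move=> h i _; exact: h.
  by move=> h i; apply: h => //=; rewrite mem_index_enum.
rewrite -product_measure1E//= /distribution /pushforward; congr (_ _).
apply/seteqP; split=> -[x t] /=.
  move=> h; split; first exact: h ord0.
  by move=> i; have := h (lift ord0 i); rewrite tnthS.
move=> [h0 h] i; case: (unliftP ord0 i) => [j ->|->//].
by rewrite tnthS; exact: h.
Qed.

End iid.

(* The class N, parametrized injectively by mean and standard deviation. *)
Record normal_law (R : realType) := NormalLaw {
  mean : R;
  stddev : R;
  stddev_gt0 : 0 < stddev }.

(* The second parameter of normal_prob is the standard deviation. *)
Definition normal_sample (R : realType) (n : nat) (P : normal_law R) :
    probability (n.-tuple (measurableTypeR R)) R :=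
  iid (normal_prob (mean P) (stddev P)) n.

Definition lower_confidence_bounds (R : realType) (alpha : R) (n : nat) :
    set (n.-tuple (measurableTypeR R) -> R) :=
  [set L : n.-tuple (measurableTypeR R) -> R | measurable_fun setT L /\
    forall P : normal_law R,
      ((1 - alpha)%:E <= normal_sample n P [set x | (mean P >= L x)%R])%E].
Arguments lower_confidence_bounds {R} alpha n.

(* A solution w of Q (Y >= w) = eps need not exist when Y has atoms, and need
   not be unique.  The two inequalities are satisfied by every such solution
   (exact_upper_quantile), amount to the equation when Q (Y = w) = 0, and can
   always be met when 0 < eps < 1 (ex_upper_quantile). *)
Definition is_upper_quantile (d : measure_display) (T : measurableType d)
    (R : realType) (Q : probability T R) (Y : T -> R) (eps w : R) : Prop :=
  (eps%:E <= Q [set x | (Y x >= w)%R])%E /\ (Q [set x | (Y x > w)%R] <= eps%:E)%E.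

(* w is a version of W_eps(L, P). *)
Definition is_W (R : realType) (n : nat) (eps : R) (L : n.-tuple (measurableTypeR R) -> R)
    (P : normal_law R) (w : R) : Prop :=
  is_upper_quantile (normal_sample n P) (fun x => mean P - L x) eps w.

(* W L P stands for W_(2 alpha)(L, P); the infimum and the supremum are taken in
   the extended reals. *)
Definition Mminus (R : realType) (alpha : R) (n : nat)
    (W : (n.-tuple (measurableTypeR R) -> R) -> normal_law R -> R) : \bar R :=
  ereal_inf [set ereal_sup [set ((stddev P)^-1 * W L P)%:E | P in [set: normal_law R]]
            | L in lower_confidence_bounds alpha n].

Section upper_quantile_facts.
Context (d : measure_display) (T : measurableType d) (R : realType).
Variables (Q : probability T R) (Y : T -> R).
Hypothesis mY : measurable_fun [set: T] Y.

Let mge w : measurable [set x | Y x >= w].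
Proof.
rewrite (_ : [set _ | _] = setT `&` Y @^-1` `[w, +oo[) ; first exact: mY.
by rewrite setTI; apply/seteqP; split=> x /=; rewrite in_itv/= andbT.
Qed.

Let mgt w : measurable [set x | Y x > w].
Proof.
rewrite (_ : [set _ | _] = setT `&` Y @^-1` `]w, +oo[) ; first exact: mY.
by rewrite setTI; apply/seteqP; split=> x /=; rewrite in_itv/= andbT.
Qed.

Lemma exact_upper_quantile (eps w : R) :
  Q [set x | Y x >= w] = eps%:E -> is_upper_quantile Q Y eps w.
Proof.
move=> e; split; rewrite -e// le_measure ?inE//.
by move=> x /=; exact: ltW.
Qed.

Lemma upper_quantile_exact (eps w : R) : Q [set x | Y x = w] = 0%E ->
  is_upper_quantile Q Y eps w -> Q [set x | Y x >= w] = eps%:E.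
Proof.
move=> q0 [h1 h2]; apply/le_anti; rewrite h1 andbT.
rewrite (_ : [set x | Y x >= w] = [set x | Y x > w] `|` [set x | Y x = w]).
  have mw : measurable [set x | Y x = w].
    rewrite (_ : [set _ | _] = setT `&` Y @^-1` [set w]); first exact: mY.
    by rewrite setTI.
  by apply: le_trans (measureU2 Q (mgt w) mw) _; rewrite /= q0 adde0.
apply/seteqP; split=> x /=; rewrite le_eqVlt.
  by case/predU1P => [->|]; [right|left].
by case=> [->|->]; rewrite ?orbT ?eqxx.
Qed.

Lemma ex_upper_quantile (eps : R) :
  0 < eps < 1 -> exists w, is_upper_quantile Q Y eps w.
Proof.
move=> /andP[e0 e1].
pose S := [set w | (Q [set x | (Y x > w)%R] <= eps%:E)%E].
have Qfin A : measurable A -> Q A \is a fin_num by move=> mA; exact: fin_num_measure.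
have S0 : S !=set0.
  have : Q [set x | Y x > k%:R] @[k --> \oo] --> Q (\bigcap_k [set x | Y x > k%:R]).
    apply: nonincreasing_cvg_mu => //.
    - by rewrite -ge0_fin_numE// Qfin.
    - exact: bigcap_measurable.
    - move=> a b ab; apply/subsetPset => x /=; apply: le_lt_trans.
      by rewrite ler_nat.
  rewrite (_ : \bigcap_k _ = set0); last first.
    rewrite -subset0 => x /(_ (Num.truncn (Y x)).+1 I) /=.
    by rewrite ltNge ltW// truncnS_gt.
  rewrite measure0 => /fine_cvgP[_ /cvgrPdist_lt/(_ _ e0)[k _ /(_ k (leqnn _))]].
  rewrite /= sub0r normrN ger0_norm ?fine_ge0// => h.
  by exists k%:R; rewrite /S/= -[leLHS]fineK ?Qfin// lee_fin ltW.
have lbS : has_lbound S.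
  have : Q [set x | Y x > - k%:R] @[k --> \oo] --> Q (\bigcup_k [set x | Y x > - k%:R]).
    apply: nondecreasing_cvg_mu => //.
    - exact: bigcup_measurable.
    - move=> a b ab; apply/subsetPset => x /=; apply: le_lt_trans.
      by rewrite lerN2 ler_nat.
  rewrite (_ : \bigcup_k _ = setT); last first.
    rewrite -subTset => x _; exists (Num.truncn (- Y x)).+1 => //=.
    by rewrite ltrNl truncnS_gt.
  rewrite probability_setT => /fine_cvgP[_ /cvgrPdist_lt].
  have e1' : 0 < 1 - eps by rewrite subr_gt0.
  move=> /(_ _ e1')[k _ /(_ k (leqnn _))].
  rewrite /= => /(le_lt_trans (ler_norm _)); rewrite ltrD2l ltrN2 => h.
  exists (- k%:R) => w /= Sw; rewrite leNgt; apply/negP => wk.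
  move: h; rewrite ltNge => /negP; apply.
  rewrite -lee_fin fineK ?Qfin//; apply: le_trans Sw.
  by apply: le_measure; rewrite ?inE// => x /=; exact: lt_trans.
have hS : has_inf S by split.
exists (inf S); split.
  have : Q [set x | Y x > inf S - k.+1%:R^-1] @[k --> \oo] -->
         Q (\bigcap_k [set x | Y x > inf S - k.+1%:R^-1]).
    apply: nonincreasing_cvg_mu => //.
    - by rewrite -ge0_fin_numE// Qfin.
    - exact: bigcap_measurable.
    - move=> a b ab; apply/subsetPset => x /=; apply: le_lt_trans.
      by rewrite lerD2l lerN2 lef_pV2 ?posrE// ler_nat.
  rewrite (_ : \bigcap_k _ = [set x | Y x >= inf S]); last first.
    apply/seteqP; split => x /=.
      move=> h; rewrite leNgt; apply/negP => /ltr_add_invr[k].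
      by rewrite -ltrBrDr => /lt_trans /(_ (h k I)); rewrite ltxx.
    move=> h k _ /=; apply: lt_le_trans h.
    by rewrite ltrBlDr ltrDl.
  move=> h; rewrite -(cvg_lim _ h)//; apply: lime_ge; first by apply/cvg_ex; eexists; exact: h.
  near=> k; rewrite leNgt; apply/negP => /ltW Sk.
  have := ge_inf lbS Sk; rewrite leNgt => /negP; apply.
  by rewrite ltrBlDr ltrDl.
have : Q [set x | Y x > inf S + k.+1%:R^-1] @[k --> \oo] -->
       Q (\bigcup_k [set x | Y x > inf S + k.+1%:R^-1]).
  apply: nondecreasing_cvg_mu => //.
  - exact: bigcup_measurable.
  - move=> a b ab; apply/subsetPset => x /=; apply: le_lt_trans.
    by rewrite lerD2l lef_pV2 ?posrE// ler_nat.
rewrite (_ : \bigcup_k _ = [set x | Y x > inf S]); last first.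
  apply/seteqP; split => x /=.
    by move=> [k _] /=; apply: lt_trans; rewrite ltrDl.
  by move=> /ltr_add_invr[k h]; exists k.
move=> h; rewrite -(cvg_lim _ h)//; apply: lime_le; first by apply/cvg_ex; eexists; exact: h.
near=> k.
have k0 : 0 < k.+1%:R^-1 :> R by rewrite invr_gt0 ltr0n.
have [w Sw wk] := inf_adherent k0 hS.
apply: le_trans Sw.
by apply: le_measure; rewrite ?inE// => x /=; exact: lt_trans.
Unshelve. all: by end_near. Qed.

End upper_quantile_facts.

(* Some W satisfying the hypothesis of the main statement exists. *)
Lemma ex_W (R : realType) (alpha : R) (n : nat) : 0 < alpha < 1 / 3 ->
  exists W : (n.-tuple (measurableTypeR R) -> R) -> normal_law R -> R,
    forall L P, lower_confidence_bounds alpha n L ->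
      is_W (2 * alpha) L P (W L P).
Proof.
move=> /andP[a0 a1].
have h (LP : (n.-tuple (measurableTypeR R) -> R) * normal_law R) : exists w,
    lower_confidence_bounds alpha n LP.1 -> is_W (2 * alpha) LP.1 LP.2 w.
  have [[mL _]|] := pselect (lower_confidence_bounds alpha n LP.1); last by exists 0.
  have [||w hw] := @ex_upper_quantile _ _ _ (normal_sample n LP.2)
    (fun x => mean LP.2 - LP.1 x) _ (2 * alpha).
  - by apply: measurable_realfun.measurable_funB.
  - rewrite mulr_gt0//=; apply: (@lt_trans _ _ (2 * (1 / 3))).
      by rewrite ltr_pM2l.
    by rewrite mul1r ltr_pdivrMr// mul1r ltr_nat.
  - by exists w.
have [W hW] := choice h.
by exists (fun L P => W (L, P)) => L P; exact: (hW (L, P)).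
Qed.

(* Main.v *)
(* Let K be the claimed bound, c = 6 alpha - 9 alpha^2 = 1 - (1 - 3 alpha)^2 and
   s^2 = 1 + K^2, so that c = s^(-n).  If W_(2 alpha)(L, N(0,1)) < K, then the
   event L <= -K has probability at most 2 alpha under N(0,1), whereas by coverage
   it has probability at least 1 - alpha under N(-K, s^2).  The Hellinger affinity
   rho of two laws satisfies rho^(2n) <= 1 - (a - b)^2 when some event of the
   n-sample has probabilities a and b, so here rho^(2n) <= c.  But for N(-K, s^2)
   and N(0,1) one computes rho^2 > 1/s, hence rho^(2n) > c. *)
Require Import Defs.
From mathcomp Require Import all_boot all_order all_algebra.
From mathcomp Require Import all_classical all_reals all_analysis.
From mathcomp Require Import measurable_realfun ring lra.
Import Order.TTheory GRing.Theory Num.Theory.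
Local Open Scope classical_set_scope.
Local Open Scope ring_scope.

(** * Integration tools: Cauchy-Schwarz and change of density *)

Lemma integral_sqrtM_le {d : measure_display} {T : measurableType d}
    {R : realType} (mu : {measure set T -> \bar R}) (f g : T -> R) (a b : R) :
    measurable_fun setT f -> measurable_fun setT g ->
    (forall x, 0 <= f x) -> (forall x, 0 <= g x) ->
    (\int[mu]_x (f x)%:E = a%:E)%E -> (\int[mu]_x (g x)%:E = b%:E)%E ->
  (\int[mu]_x (Num.sqrt (f x * g x))%:E <= (Num.sqrt (a * b))%:E)%E.
Proof.
move=> mf mg f0 g0 fa gb.
have msqrt h : measurable_fun [set: T] h ->
    measurable_fun setT (fun x => Num.sqrt (h x : R)).
  by move=> mh; apply: measurableT_comp => //; apply: continuous_measurable_fun; exact: sqrt_continuous.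
have N2 h c : (forall x, 0 <= h x) -> (\int[mu]_x (h x)%:E = c%:E)%E ->
    Lnorm mu 2%:E (EFin \o (fun x => Num.sqrt (h x))) = (Num.sqrt c)%:E.
  move=> h0 hc; have c0 : 0 <= c.
    by rewrite -lee_fin -hc; apply: integral_ge0 => x _; rewrite lee_fin.
  rewrite unlock.
  under eq_integral => x _.
    rewrite /= ger0_norm ?sqrtr_ge0// powR_mulrn ?sqrtr_ge0// sqr_sqrtr//.
    over.
  by rewrite hc poweR_EFin powR12_sqrt.
have a0 : 0 <= a.
  by rewrite -lee_fin -fa; apply: integral_ge0 => x _; rewrite lee_fin.
have := @hoelder _ _ _ mu _ _ 2 2 (msqrt _ mf) (msqrt _ mg).
rewrite (N2 f a)// (N2 g b)// Lnorm1 -EFinM -sqrtrM//.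
move=> h; apply: le_trans (h _ _ _) => //; last by rewrite [RHS]splitr !div1r.
rewrite le_eqVlt; apply/orP; left; apply/eqP; apply: eq_integral => x _ /=.
by rewrite sqrtrM// ger0_norm// mulr_ge0 ?sqrtr_ge0.
Qed.

(** [p] and the Radon-Nikodym derivative of [P] have the same integral over every measurable set,
    hence agree [mu]-almost everywhere. *)
Lemma integral_density {d : measure_display} {T : measurableType d}
    {R : realType} (mu : {sigma_finite_measure set T -> \bar R})
    (P : {finite_measure set T -> \bar R}) (p : T -> R) (f : T -> \bar R) :
    mu.-integrable setT (EFin \o p) ->
    (forall A, measurable A -> P A = \int[mu]_(x in A) (p x)%:E)%E ->
    P.-integrable setT f ->
  (\int[P]_x f x = \int[mu]_x (f x * (p x)%:E))%E.
Proof.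
move=> ip Pp fi.
have mp : measurable_fun setT (EFin \o p) by exact: measurable_int ip.
have Pmu : P `<< mu.
  apply/null_content_dominatesP => A mA A0; rewrite Pp//.
  by apply: null_set_integral => //; exact: measurable_funTS.
rewrite -(Radon_Nikodym_change_of_variables Pmu)//.
have mf : measurable_fun setT f by exact: measurable_int fi.
have iRN : mu.-integrable setT (Radon_Nikodym (charge_of_finite_measure P) mu).
  exact: Radon_Nikodym_integrable.
apply: ae_eq_integral => //.
- by apply: emeasurable_funM => //; exact: measurable_int iRN.
- exact: emeasurable_funM.
- apply: ae_eqe_mul2l; apply: integral_ae_eq => //.
  by move=> E _ mE; rewrite -Radon_Nikodym_integral//= -Pp.
Qed.

(** Holds by computation, the product measure being an integral of section measures; this is what
    lets the induction below condition on the first coordinate. *)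
Lemma iidS {d : measure_display} {T : measurableType d} {R : realType}
    (P : probability T R) (n : nat) (A : set (n.+1.-tuple T)) :
  (iid P n.+1 A =
    \int[P]_x iid P n (xsection (@cons_pair _ T n @^-1` A) x))%E.
Proof. by []. Qed.

(** * Affinity of i.i.d. samples and the probabilities of one event *)

Section bhattacharyya.
Context {d : measure_display} {T : measurableType d} {R : realType}.
Variables (mu : {sigma_finite_measure set T -> \bar R}).
Variables (P Q : probability T R) (p q : T -> R).
Hypotheses (p_ge0 : forall x, 0 <= p x) (q_ge0 : forall x, 0 <= q x).
Hypotheses (ip : mu.-integrable setT (EFin \o p))
  (iq : mu.-integrable setT (EFin \o q)).
Hypothesis Pp : (forall A, measurable A -> P A = \int[mu]_(x in A) (p x)%:E)%E.
Hypothesis Qq : (forall A, measurable A -> Q A = \int[mu]_(x in A) (q x)%:E)%E.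

(* Induction on [n], applying the induction hypothesis to the sections of [A] and
   Cauchy-Schwarz in the first coordinate: no density on the product is needed. *)
Lemma affinity_iid_le (rho : R) (n : nat) (A : set (n.-tuple T)) :
    (\int[mu]_x (Num.sqrt (p x * q x))%:E = rho%:E)%E -> measurable A ->
  rho ^+ n <= Num.sqrt (fine (iid P n A) * fine (iid Q n A)) +
    Num.sqrt ((1 - fine (iid P n A)) * (1 - fine (iid Q n A))).
Proof.
move=> hrho; elim: n A => [|n IHn] A mA.
  (* Both laws are the same point mass, so [A] has probability 0 under both or 1 under both, and the
     right-hand side is 1. *)
  rewrite /= /dirac indicE expr0; case: (_ \in A) => /=.
    by rewrite mulr1 subrr mulr0 sqrtr1 sqrtr0 addr0.
  by rewrite mulr0 subr0 mulr1 sqrtr1 sqrtr0 add0r.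
have mp : measurable_fun setT p by apply/measurable_EFinP; exact: measurable_int ip.
have mq : measurable_fun setT q by apply/measurable_EFinP; exact: measurable_int iq.
set A' := @cons_pair _ T n @^-1` A.
have mA' : measurable A'.
  by rewrite -[A']setTI; exact: measurable_cons_pair.
(* Conditional probability of [A] given that the first coordinate is [x]. *)
pose u (P' : probability T R) x := fine (iid P' n (xsection A' x)).
have mu_ P' : measurable_fun setT (u P').
  apply/measurable_EFinP.
  rewrite (_ : _ \o _ = iid P' n \o xsection A').
    exact: measurable_fun_xsection.
  apply/funext => x /=; rewrite /u fineK// fin_num_measure//.
  exact: measurable_xsection.
have u01 P' x : 0 <= u P' x <= 1.
  have mX : measurable (xsection A' x) by exact: measurable_xsection.
  by rewrite fine_ge0//= -lee_fin fineK ?probability_le1// fin_num_measure.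
have aE (P' : probability T R) (p' : T -> R) :
    mu.-integrable setT (EFin \o p') ->
    (forall A, measurable A -> P' A = \int[mu]_(x in A) (p' x)%:E)%E ->
    (\int[mu]_x (u P' x * p' x)%:E = (fine (iid P' n.+1 A))%:E)%E /\
    (\int[mu]_x ((1 - u P' x) * p' x)%:E = (1 - fine (iid P' n.+1 A))%:E)%E.
  move=> ip' Pp'.
  have iu : P'.-integrable setT (EFin \o u P').
    apply: (@le_integrable _ _ _ _ _ _ _ (cst 1%E)) => //.
    - exact/measurable_EFinP.
    - move=> x _ /=; rewrite lee_fin normr1 ger0_norm; by case/andP: (u01 P' x).
    - exact: finite_measure_integrable_cst.
  have iu1 : P'.-integrable setT (EFin \o (fun x => 1 - u P' x)).
    rewrite (_ : _ \o _ = cst 1%E \- (EFin \o u P'))%E//.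
    by apply: integrableB => //; exact: finite_measure_integrable_cst.
  have E1 : (\int[P']_x (u P' x)%:E = (fine (iid P' n.+1 A))%:E)%E.
    rewrite fineK ?fin_num_measure// iidS; apply: eq_integral => x _.
    by rewrite fineK// fin_num_measure//; exact: measurable_xsection.
  split.
    rewrite -E1 (@integral_density _ _ _ mu P' p')//.
  under eq_integral do rewrite EFinM.
  rewrite -(@integral_density _ _ _ mu P' p' (EFin \o (fun x => 1 - u P' x)))//=.
  under eq_integral do rewrite EFinB.
  rewrite integralB_EFin//; last exact: finite_measure_integrable_cst.
  rewrite E1 integral_cst// [X in (1 * X)%E](_ : _ = 1%E) ?mule1//.
  exact: probability_setT.
have [aP1 aP2] := aE P p ip Pp.
have [bQ1 bQ2] := aE Q q iq Qq.
have u0 P' x : 0 <= u P' x by case/andP: (u01 P' x).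
have u1 P' x : 0 <= 1 - u P' x by rewrite subr_ge0; case/andP: (u01 P' x).
have m1u P' : measurable_fun setT (fun x => 1 - u P' x).
  exact: measurable_funB.
(* Cauchy-Schwarz is applied once for [A] and once for its complement, giving the two roots of the
   goal. *)
have C1 := @integral_sqrtM_le _ _ _ mu _ _ _ _ (measurable_funM (mu_ P) mp)
  (measurable_funM (mu_ Q) mq) (fun x => mulr_ge0 (u0 P x) (p_ge0 x))
  (fun x => mulr_ge0 (u0 Q x) (q_ge0 x)) aP1 bQ1.
have C2 := @integral_sqrtM_le _ _ _ mu _ _ _ _ (measurable_funM (m1u P) mp)
  (measurable_funM (m1u Q) mq) (fun x => mulr_ge0 (u1 P x) (p_ge0 x))
  (fun x => mulr_ge0 (u1 Q x) (q_ge0 x)) aP2 bQ2.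
have msqrt h : measurable_fun [set: T] h ->
    measurable_fun setT (fun x => (Num.sqrt (h x : R))%:E).
  by move=> mh; apply/measurable_EFinP; apply: measurableT_comp => //; apply: continuous_measurable_fun; exact: sqrt_continuous.
rewrite -lee_fin EFinD; apply: le_trans (leeD C1 C2).
rewrite -ge0_integralD//; last 2 first.
- by apply: msqrt; do 2 apply: measurable_funM.
- by apply: msqrt; do 2 apply: measurable_funM.
have rho0 : 0 <= rho.
  by rewrite -lee_fin -hrho; apply: integral_ge0 => x _; rewrite lee_fin.
rewrite exprSr EFinM -hrho -ge0_integralZl//; last 2 first.
- by apply: msqrt; apply: measurable_funM.
- by rewrite lee_fin exprn_ge0.
apply: ge0_le_integral => //.
- by move=> x _; rewrite -EFinM lee_fin mulr_ge0 ?exprn_ge0.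
- apply: measurable_funeM; apply: msqrt; exact: measurable_funM.
- by apply: emeasurable_funD; apply: msqrt; do 2 apply: measurable_funM.
move=> x _; rewrite -EFinM -EFinD lee_fin.
(* Pointwise, [sqrt (p x * q x)] factors out of both roots; what remains is the induction hypothesis
   for the section of [A] at [x]. *)
rewrite !(mulrACA _ (p x)) ![in leRHS]sqrtrM ?mulr_ge0// -mulrDl.
rewrite -!sqrtrM//; apply: ler_wpM2r => //.
by apply: IHn; exact: measurable_xsection.
Qed.

(** Square [affinity_iid_le]. The cross term equals 2 sqrt(a(1-a)) sqrt(b(1-b)), at most a(1-a) +
    b(1-b), and the sum collapses to 1 - (a-b)^2. *)
Lemma affinity_iid_test (rho : R) (n : nat) (A : set (n.-tuple T)) :
    (\int[mu]_x (Num.sqrt (p x * q x))%:E = rho%:E)%E -> measurable A ->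
  (rho ^+ 2) ^+ n <= 1 - (fine (iid P n A) - fine (iid Q n A)) ^+ 2.
Proof.
move=> hrho mA; have := affinity_iid_le _ _ _ hrho mA.
have f01 (P' : probability T R) : 0 <= fine (iid P' n A) <= 1.
  by rewrite fine_ge0//= -lee_fin fineK ?probability_le1// fin_num_measure.
move: (f01 P) (f01 Q); set a := fine _; set b := fine _ => /andP[a0 a1] /andP[b0 b1].
have rho0 : 0 <= rho.
  by rewrite -lee_fin -hrho; apply: integral_ge0 => x _; rewrite lee_fin.
move=> h; rewrite exprAC.
apply: (@le_trans _ _ ((Num.sqrt (a * b) + Num.sqrt ((1 - a) * (1 - b))) ^+ 2)).
  by rewrite lerXn2r// nnegrE ?addr_ge0 ?exprn_ge0.
have h1 : 0 <= (1 - a) * (1 - b) by rewrite mulr_ge0 ?subr_ge0.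
rewrite sqrrD !sqr_sqrtr ?mulr_ge0 ?subr_ge0// -sqrtrM ?mulr_ge0// mulrACA.
rewrite sqrtrM ?mulr_ge0 ?subr_ge0//.
have := sqr_ge0 (Num.sqrt (a * (1 - a)) - Num.sqrt (b * (1 - b))).
rewrite sqrrB !sqr_sqrtr ?mulr_ge0 ?subr_ge0//.
set x := _ * _ *+ 2; lra.
Qed.

End bhattacharyya.

(** * Affinity of two normal laws *)

(** Completing the square in the averaged exponents: [m] is the precision-weighted mean, [s ^+ 2]
    the harmonic mean of the variances. As [normal_pdf m s] has mass 1, the constant in front is the
    affinity. *)
Lemma sqrt_normal_pdfM {R : realType} (m1 m2 s1 s2 : R) :
    0 < s1 -> 0 < s2 ->
    let m := (m1 * s2 ^+ 2 + m2 * s1 ^+ 2) / (s1 ^+ 2 + s2 ^+ 2) in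
    let s := Num.sqrt (2 * s1 ^+ 2 * s2 ^+ 2 / (s1 ^+ 2 + s2 ^+ 2)) in
  forall x, Num.sqrt (normal_pdf m1 s1 x * normal_pdf m2 s2 x) =
    Num.sqrt (2 * s1 * s2 / (s1 ^+ 2 + s2 ^+ 2)) *
    expR (- (m1 - m2) ^+ 2 / (4 * (s1 ^+ 2 + s2 ^+ 2))) * normal_pdf m s x.
Proof.
move=> s10 s20 m s x.
have D0 : 0 < s1 ^+ 2 + s2 ^+ 2 by rewrite addr_gt0// exprn_gt0.
have V0 : 0 < 2 * s1 ^+ 2 * s2 ^+ 2 / (s1 ^+ 2 + s2 ^+ 2).
  by rewrite divr_gt0// !mulr_gt0// exprn_gt0.
have C0 : 0 <= 2 * s1 * s2 / (s1 ^+ 2 + s2 ^+ 2).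
  by rewrite divr_ge0 ?(ltW D0)// !mulr_ge0// ltW.
have s0 : 0 < s by rewrite sqrtr_gt0.
have sE : s ^+ 2 = 2 * s1 ^+ 2 * s2 ^+ 2 / (s1 ^+ 2 + s2 ^+ 2).
  by rewrite sqr_sqrtr// ltW.
have k0 : 0 < Num.sqrt (pi *+ 2 : R) by rewrite sqrtr_gt0 mulrn_wgt0// pi_gt0.
have peakE (t : R) : 0 < t -> normal_peak t = (t * Num.sqrt (pi *+ 2))^-1.
  by move=> t0; rewrite /normal_peak -mulrnAr sqrtrM ?sqr_ge0// sqrtr_sqr gtr0_norm.
(* Both sides are nonnegative, so they are squared to remove the roots; prefactors and exponents are
   then compared separately. *)
apply/eqP; rewrite -(@eqrXn2 _ 2)//; last first.
  by rewrite !mulr_ge0 ?expR_ge0 ?normal_pdf_ge0.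
apply/eqP; rewrite sqr_sqrtr ?mulr_ge0 ?normal_pdf_ge0//.
rewrite !exprMn sqr_sqrtr// !normal_pdfE ?gt_eqF// !peakE// /normal_fun.
move: k0; set k := Num.sqrt _ => k0.
rewrite exprMn exprVn exprMn sE -!expRM_natl.
rewrite [LHS]mulrACA [RHS]mulrACA -!expRD.
congr (_ * expR _).
  by field; rewrite !gt_eqF.
rewrite /m; field.
by rewrite !gt_eqF.
Qed.

Lemma integral_sqrt_normal_pdfM {R : realType} (m1 m2 s1 s2 : R) :
    0 < s1 -> 0 < s2 ->
  (\int[lebesgue_measure]_x
      (Num.sqrt (normal_pdf m1 s1 x * normal_pdf m2 s2 x))%:E =
    (Num.sqrt (2 * s1 * s2 / (s1 ^+ 2 + s2 ^+ 2)) *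
    expR (- (m1 - m2) ^+ 2 / (4 * (s1 ^+ 2 + s2 ^+ 2))))%:E)%E.
Proof.
move=> s10 s20.
under eq_integral do rewrite sqrt_normal_pdfM// EFinM.
rewrite integralZl//; last exact: integrable_normal_pdf.
by rewrite integral_normal_pdf mule1.
Qed.

(* The right-hand side is the squared affinity of N(-K, s^2) and N(0, 1) when
   s^2 = 1 + K^2; replacing [expR x] by [1 + x] already gives the bound. *)
Lemma inv_lt_normal_affinity {R : realType} (s : R) : 1 < s ->
  s^-1 < 2 * s / (s ^+ 2 + 1) * expR (- (s ^+ 2 - 1) / (2 * (s ^+ 2 + 1))).
Proof.
move=> s1; have s0 : 0 < s by exact: lt_trans s1.
have s21 : 1 < s ^+ 2 by rewrite expr_gt1// ltW.
have D0 : 0 < s ^+ 2 + 1 by rewrite addr_gt0// exprn_gt0.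
apply: lt_le_trans (_ : 2 * s / (s ^+ 2 + 1) *
    (1 + - (s ^+ 2 - 1) / (2 * (s ^+ 2 + 1))) <= _); last first.
  by rewrite ler_wpM2l ?expR_ge1Dx// divr_ge0 ?mulr_ge0// ltW.
rewrite -subr_gt0 (_ : _ - _ = (s ^+ 2 - 1) / (s * (s ^+ 2 + 1) ^+ 2)).
  by rewrite divr_gt0 ?subr_gt0// mulr_gt0// exprn_gt0.
by field; rewrite !gt_eqF.
Qed.

(** * Comparison of N(-K, s^2) with N(0, 1) through one event *)

Theorem theorem6p1 (R : realType) (n : nat) (n_gt0 : (0 < n)%N)
    (alpha : R) (alpha_gt0 : 0 < alpha) (alpha_lt : alpha < 1 / 3)
    (W : (n.-tuple (measurableTypeR R) -> R) -> normal_law R -> R)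
    (W_quantile : forall (L : n.-tuple (measurableTypeR R) -> R) (P : normal_law R),
      lower_confidence_bounds alpha n L -> is_W (2 * alpha) L P (W L P)) :
  ((Num.sqrt ((6 * alpha - 9 * alpha ^+ 2) `^ (- 2 / n%:R) - 1))%:E
    <= Mminus alpha W)%E.
Proof.
set c := 6 * alpha - 9 * alpha ^+ 2.
have c0 : 0 < c by rewrite /c; nra.
have c1 : c < 1 by rewrite /c; nra.
pose s := c `^ (- 1 / n%:R).
have nR0 : 0 < n%:R :> R by rewrite ltr0n.
have s0 : 0 < s by rewrite powR_gt0.
have s2E : c `^ (- 2 / n%:R) = s ^+ 2.
  rewrite -powR_mulrn ?(ltW s0)// -powRrM; congr (_ `^ _); field.
  by rewrite gt_eqF.
have snE : s ^+ n = c^-1.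
  rewrite -powR_mulrn ?(ltW s0)// -powRrM -(powR_inv1 (ltW c0)).
  by congr (_ `^ _); field; rewrite gt_eqF.
have s1 : 1 < s.
  rewrite -(@expr_gt1 _ n) ?(ltW s0)// snE.
  by rewrite invf_gt1.
rewrite s2E; set K := Num.sqrt _.
have KE : K ^+ 2 = s ^+ 2 - 1.
  by rewrite sqr_sqrtr// subr_ge0 ltW// expr_gt1// ltW.
apply: le_ereal_inf_tmp => _ [L LL <-].
pose Q := @NormalLaw R 0 1 ltr01.
pose P := @NormalLaw R (- K) s s0.
(* The supremum is bounded below by its value at N(0, 1), where the standard deviation is 1. *)
apply: le_ereal_sup_tmp; exists ((stddev Q)^-1 * W L Q)%:E; first by exists Q.
rewrite /= invr1 mul1r lee_fin leNgt; apply/negP => WK.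
have [mL Lcov] := LL.
have [_ WQ] := W_quantile L Q LL.
(* Since [mean P] is [- K], this is exactly the coverage event under [P]; since [W L Q < K], it lies
   inside the event that [0 - L x] exceeds [W L Q]. *)
pose A := [set x | L x <= - K].
have mA : measurable A.
  rewrite (_ : A = setT `&` L @^-1` `]-oo, (- K)]); first exact: mL.
  by rewrite setTI; apply/seteqP; split=> x /=; rewrite in_itv.
have PA : 1 - alpha <= fine (normal_sample n P A).
  by rewrite -lee_fin fineK ?fin_num_measure//; exact: Lcov.
have QA : fine (normal_sample n Q A) <= 2 * alpha.
  rewrite -lee_fin fineK ?fin_num_measure//; apply: le_trans WQ.
  have mW : measurable [set x | (0 - L x > W L Q)%R].
    rewrite (_ : [set _ | _] = setT `&` L @^-1` `]-oo, (- W L Q)[); first exact: mL.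
    by rewrite setTI; apply/seteqP; split=> x /=; rewrite in_itv/= sub0r ltrNr.
  apply: le_measure; rewrite ?inE// => x /=; rewrite /A /= => LK.
  by rewrite sub0r (lt_le_trans WK)// lerNr.
have aff := @integral_sqrt_normal_pdfM R (- K) 0 s 1 s0 ltr01.
have := @affinity_iid_test _ _ _ (@lebesgue_measure R)
  (normal_prob (- K) s) (normal_prob 0 1) (normal_pdf (- K) s) (normal_pdf 0 1)
  (normal_pdf_ge0 _ _) (normal_pdf_ge0 _ _)
  (integrable_normal_pdf _ _) (integrable_normal_pdf _ _)
  (fun _ _ => erefl) (fun _ _ => erefl) _ n A aff mA.
move: PA QA; rewrite /normal_sample /=.
set a := fine _; set b := fine _ => PA QA.
apply/negP; rewrite -ltNge.
(* Here a - b >= 1 - 3 alpha > 0, so 1 - (a-b)^2 <= 1 - (1 - 3 alpha)^2 = c. *)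
apply: (@le_lt_trans _ _ c); first by rewrite /c; nra.
(* With c written as the [n]-th power of [s^-1] and [n] positive, it suffices to compare the bases
   [s^-1] and rho^2. *)
rewrite -[ltLHS]invrK -snE -exprVn.
rewrite ltrXn2r -?lt0n// ?invr_ge0 ?(ltW s0)// ?sqr_ge0//.
have := inv_lt_normal_affinity _ s1.
rewrite exprMn sqr_sqrtr; last first.
  by rewrite divr_ge0 ?mulr_ge0 ?addr_ge0 ?sqr_ge0// ltW.
rewrite -expRM_natl subr0 sqrrN KE expr1n mulr1.
congr (_ < _ * expR _); field.
by rewrite gt_eqF// addr_gt0// exprn_gt0.
Qed.
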